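(* Let $n\ge 3$ and let $F_n^3(0)$ be the complex $n$-dimensional (Lie, hence Leibniz) algebra with basis $\{x_1,\dots,x_n\}$ and multiplication $[x_i,x_1]=-[x_1,x_i]=x_{i+1}$ for $2\le i\le n-1$ (all other products of basis elements are zero). Then the cochains $\psi_1,\psi_2,\psi_3$, defined as the bilinear maps with $\psi_1(x_1,x_1)=x_n$, $\psi_2(x_1,x_2)=x_n$, $\psi_3(x_2,x_2)=x_n$ (all other values on pairs of basis elements being zero), complement the subspace $Z^2(F_n^3(0),F_n^3(0))$ to the space $ZL^2(F_n^3(0),F_n^3(0))$, i.e. $ZL^2(F_n^3(0),F_n^3(0))=Z^2(F_n^3(0),F_n^3(0))\oplus\langle\psi_1,\psi_2,\psi_3\rangle$ with $\psi_1,\psi_2,\psi_3$ linearly independent.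
   Context: For a Leibniz algebra $L$ (right Leibniz identity $[x,[y,z]]=[[x,y],z]-[[x,z],y]$), $ZL^2(L,L)$ is the space of Leibniz infinitesimal deformations ($2$-cocycles): bilinear maps $\varphi:L\times L\to L$ with $$[x,\varphi(y,z)]-[\varphi(x,y),z]+[\varphi(x,z),y]+\varphi(x,[y,z])-\varphi([x,y],z)+\varphi([x,z],y)=0$$ for all $x,y,z\in L$. For a Lie algebra $L$, $Z^2(L,L)$ is the space of Lie infinitesimal deformations: those $\varphi\in ZL^2(L,L)$ that satisfy $\varphi(x,y)=-\varphi(y,x)$ for all $x,y$. *)

(* Defs.v *)
From HB Require Import structures.
From mathcomp Require Import all_boot all_order all_algebra.
From mathcomp Require Export complex.
From mathcomp Require Export reals.

Set Implicit Arguments.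
Unset Strict Implicit.
Unset Printing Implicit Defensive.

Import GRing.Theory.
Local Open Scope ring_scope.

Section Multilinear.
Variable K : fieldType.

Definition bilin (U V W : vectType K) (f : U -> V -> W) :
    'Hom(U, 'Hom(V, W)) :=
  linfun (fun x => linfun (f x)).

Definition trilin (U V W X : vectType K) (f : U -> V -> W -> X) :
    'Hom(U, 'Hom(V, 'Hom(W, X))) :=
  linfun (fun x => bilin (f x)).

Lemma linfun_linearE (U V : vectType K) (f : U -> V) :
  linear f -> linfun f =1 f.
Proof.
move=> fL.
pose F : {linear U -> V} := HB.pack f (GRing.isLinear.Build _ _ _ _ f fL).
exact: (lfunE F).
Qed.

Lemma bilinE (U V W : vectType K) (f : U -> V -> W) :
    (forall x, linear (f x)) -> (forall y, linear (f ^~ y)) ->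
  forall x y, bilin f x y = f x y.
Proof.
move=> fR fL x y; rewrite /bilin linfun_linearE; first exact: linfun_linearE.
move=> a u v; apply/lfunP => z.
by rewrite add_lfunE scale_lfunE !linfun_linearE // fL.
Qed.

Lemma trilinE (U V W X : vectType K) (f : U -> V -> W -> X) :
    (forall x y, linear (f x y)) -> (forall x z, linear (fun y => f x y z)) ->
    (forall y z, linear (fun x => f x y z)) ->
  forall x y z, trilin f x y z = f x y z.
Proof.
move=> f3 f2 f1 x y z; rewrite /trilin linfun_linearE; first exact: bilinE.
move=> a u v; apply/lfunP => s; apply/lfunP => t.
by rewrite !add_lfunE !scale_lfunE !bilinE // f1.
Qed.

Lemma linear_fun_add (U V : vectType K) (f g : U -> V) :
  linear f -> linear g -> linear (fun x => f x + g x).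
Proof.
by move=> fL gL a u v; rewrite fL gL scalerDr addrACA.
Qed.

Lemma linear_fun_sub (U V : vectType K) (f g : U -> V) :
  linear f -> linear g -> linear (fun x => f x - g x).
Proof.
by move=> fL gL a u v; rewrite fL gL opprD scalerBr addrACA.
Qed.

End Multilinear.

Section NestedHom.
Variables (K : fieldType) (U V W : vectType K).
Implicit Types f g : 'Hom(U, 'Hom(V, W)).

Lemma hom2Pl f a x x' y : f (a *: x + x') y = a *: f x y + f x' y.
Proof.
have -> : f (a *: x + x') = a *: f x + f x' by exact: linearP.
by rewrite add_lfunE scale_lfunE.
Qed.

Lemma hom2Pr f x a y y' : f x (a *: y + y') = a *: f x y + f x y'.
Proof. exact: linearP. Qed.

Lemma hom2P a f g x y : (a *: f + g) x y = a *: f x y + g x y.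
Proof. by rewrite add_lfunE scale_lfunE add_lfunE scale_lfunE. Qed.

Lemma hom2_0 x y : (0 : 'Hom(U, 'Hom(V, W))) x y = 0.
Proof. by rewrite zero_lfunE zero_lfunE. Qed.

Lemma hom2N f x y : (- f) x y = - f x y.
Proof. by rewrite opp_lfunE opp_lfunE. Qed.

Lemma hom2D f g x y : (f + g) x y = f x y + g x y.
Proof. by rewrite add_lfunE add_lfunE. Qed.

Lemma hom2Dl f x x' y : f (x + x') y = f x y + f x' y.
Proof. by have := hom2Pl f 1 x x' y; rewrite !scale1r. Qed.

Lemma hom2_sum I (r : seq I) (P : pred I) (F : I -> 'Hom(U, 'Hom(V, W))) x y :
  (\sum_(i <- r | P i) F i) x y = \sum_(i <- r | P i) F i x y.
Proof. by rewrite sum_lfunE sum_lfunE. Qed.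

Lemma hom2_ext f g : (forall x y, f x y = g x y) -> f = g.
Proof. by move=> fg; apply/lfunP => x; apply/lfunP => y; exact: fg. Qed.

Lemma hom3_0 (X : vectType K) x y z :
  (0 : 'Hom(U, 'Hom(V, 'Hom(W, X)))) x y z = 0.
Proof. by rewrite 3!zero_lfunE. Qed.

Lemma hom3P (X : vectType K) a
    (f g : 'Hom(U, 'Hom(V, 'Hom(W, X)))) x y z :
  (a *: f + g) x y z = a *: f x y z + g x y z.
Proof. by rewrite !(add_lfunE, scale_lfunE). Qed.

End NestedHom.

Local Ltac lin :=
  repeat first [apply: linear_fun_sub | apply: linear_fun_add];
  let a := fresh in let u := fresh in let v := fresh in
  move=> a u v; by rewrite ?(hom2P, hom2Pl, hom2Pr).

(* A bilinear map L x L -> L is an element of 'Hom(L, 'Hom(L, L)); an algebra *)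
(* structure on L is such a map mu, with [x, y] := mu x y.                    *)
Section Cocycles.
Variables (K : fieldType) (L : vectType K).
Implicit Types mu phi : 'Hom(L, 'Hom(L, L)).

Definition is_leibniz mu :=
  forall x y z, mu x (mu y z) = mu (mu x y) z - mu (mu x z) y.

Definition is_lie mu :=
  (forall x, mu x x = 0) /\
  (forall x y z, mu x (mu y z) + mu y (mu z x) + mu z (mu x y) = 0).

Definition cocycle_expr mu phi (x y z : L) : L :=
  mu x (phi y z) - mu (phi x y) z + mu (phi x z) y
  + phi x (mu y z) - phi (mu x y) z + phi (mu x z) y.

(* linfun only has its intended value on linear arguments; the maps below are *)
(* linear in phi, which memZL2 and mem_skew_bilin record.                     *)
Definition ZL2 mu : {vspace 'Hom(L, 'Hom(L, L))} :=
  lker (linfun (fun phi => trilin (cocycle_expr mu phi))).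

Definition skew_bilin : {vspace 'Hom(L, 'Hom(L, L))} :=
  lker (linfun (fun phi => bilin (fun x y => phi x y + phi y x))).

Definition Z2 mu : {vspace 'Hom(L, 'Hom(L, L))} := (ZL2 mu :&: skew_bilin)%VS.

Lemma lie_leibniz mu : is_lie mu -> is_leibniz mu.
Proof.
move=> [alt jac] x y z.
have skew u v : mu u v = - mu v u.
  apply/eqP; rewrite -addr_eq0; have := alt (u + v).
  by rewrite hom2Dl !linearD /= !alt add0r addr0 addrC => ->.
have /eqP := jac x y z; rewrite -addrA addr_eq0 => /eqP ->.
by rewrite (skew y) (skew z (mu x y)) (skew z x) linearN opp_lfunE opprK opprD
  opprK addrC.
Qed.

Lemma cocycle_exprE mu phi x y z :
  trilin (cocycle_expr mu phi) x y z = cocycle_expr mu phi x y z.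
Proof. by apply: trilinE => {x y z} s t; rewrite /cocycle_expr; lin. Qed.

Lemma memZL2 mu phi :
  (phi \in ZL2 mu) <-> (forall x y z, cocycle_expr mu phi x y z = 0).
Proof.
have dL x y z : linear (fun f => cocycle_expr mu f x y z).
  by rewrite /cocycle_expr; lin.
rewrite /ZL2 memv_ker linfun_linearE; last first.
  move=> a f g; apply: hom2_ext => x y; apply/lfunP => z.
  by rewrite hom3P !cocycle_exprE dL.
split=> [/eqP d0 x y z | d0].
  by rewrite -cocycle_exprE d0 hom3_0.
apply/eqP/hom2_ext => x y; apply/lfunP => z.
by rewrite cocycle_exprE d0 hom3_0.
Qed.

Lemma mem_skew_bilin phi :
  (phi \in skew_bilin) <-> (forall x y, phi x y = - phi y x).
Proof.
have symE (f : 'Hom(L, 'Hom(L, L))) x y :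
    bilin (fun u v => f u v + f v u) x y = f x y + f y x :> L.
  by apply: (bilinE (f := fun u v => f u v + f v u)) => {x y} s; cbv beta; lin.
rewrite /skew_bilin memv_ker linfun_linearE; last first.
  move=> a f g; apply: hom2_ext => x y.
  by rewrite hom2P !symE !hom2P scalerDr addrACA.
split=> [/eqP d0 x y | d0].
  by apply/eqP; rewrite -addr_eq0 -symE d0 hom2_0.
apply/eqP/hom2_ext => x y.
by rewrite symE d0 addNr hom2_0.
Qed.

Lemma memZ2 mu phi :
  (phi \in Z2 mu) <->
  (phi \in ZL2 mu /\ forall x y, phi x y = - phi y x).
Proof.
rewrite /Z2 memv_cap; split=> [/andP[-> /mem_skew_bilin] | [-> skew]] //.
exact/mem_skew_bilin.
Qed.

End Cocycles.

(* Indices run from 1 to n, as in x_1, ..., x_n; outside this range the       *)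
(* definitions below give 0.                                                  *)
Section Filiform.
Variables (K : fieldType) (n : nat).
Local Notation L := 'rV[K]_n.

Definition xb (i : nat) : L := \row_(j < n) (j.+1 == i)%:R.

Definition xcoord (i : nat) (x : L) : K := \sum_(j < n | j.+1 == i) x 0 j.

(* xb i, xb j |-> xb k and all other pairs of basis vectors |-> 0, for i and  *)
(* j between 1 and n.                                                         *)
Definition elem_bilin (i j k : nat) : 'Hom(L, 'Hom(L, L)) :=
  bilin (fun x y => (xcoord i x * xcoord j y) *: xb k).

Definition F3_0 : 'Hom(L, 'Hom(L, L)) :=
  \sum_(2 <= i < n) (elem_bilin i 1 i.+1 - elem_bilin 1 i i.+1).

Definition psi1 := elem_bilin 1 1 n.
Definition psi2 := elem_bilin 1 2 n.
Definition psi3 := elem_bilin 2 2 n.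

Lemma xcoordP i : linear (xcoord i : L -> K^o).
Proof.
move=> a u v; rewrite /xcoord scaler_sumr -big_split /=.
by apply: eq_bigr => j _; rewrite !mxE.
Qed.

Lemma xcoord_xb i a : (0 < a <= n)%N -> xcoord i (xb a) = (a == i)%:R.
Proof.
case: a => // a /= an; rewrite /xcoord.
under eq_bigr do rewrite mxE eqSS.
rewrite big_mkcond (bigD1 (Ordinal an)) //= eqxx big1 ?addr0.
  by case: ifP.
move=> j; rewrite -val_eqE /= => /negPf ->; by case: ifP.
Qed.

Lemma xb_basis : basis_of fullv [seq xb i.+1 | i : 'I_n].
Proof.
rewrite basisEdim size_map size_enum_ord dimvf /dim /= mul1n leqnn andbT.
apply/subvP => v _; rewrite [v]row_sum_delta; apply: memv_suml => j _.
apply/memvZ/memv_span/imageP; exists j => //.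
by apply/rowP => k; rewrite !mxE eqxx eqSS.
Qed.

Lemma elem_bilinE i j k x y :
  elem_bilin i j k x y = (xcoord i x * xcoord j y) *: xb k.
Proof.
apply: (bilinE (f := fun x y => (xcoord i x * xcoord j y) *: xb k)).
- move=> {x y} x a u v.
  by rewrite (xcoordP j) mulrDr scalerDl scalerA mulrCA.
- move=> {x y} y a u v.
  by rewrite (xcoordP i) mulrDl scalerDl scalerA mulrA.
Qed.

Lemma elem_bilin_xb i j k a b : (0 < a <= n)%N -> (0 < b <= n)%N ->
  elem_bilin i j k (xb a) (xb b) = if (a == i) && (b == j) then xb k else 0.
Proof.
move=> an bn; rewrite elem_bilinE !xcoord_xb // -natrM mulnb.
by case: ifP => _; rewrite ?scale1r ?scale0r.
Qed.

Lemma F3_0E x y :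
  F3_0 x y = \sum_(2 <= i < n)
    (xcoord i x * xcoord 1 y - xcoord 1 x * xcoord i y) *: xb i.+1.
Proof.
rewrite /F3_0 hom2_sum; apply: eq_bigr => i _.
by rewrite hom2D hom2N !elem_bilinE scalerBl.
Qed.

Lemma F3_0_xb a b : (0 < a <= n)%N -> (0 < b <= n)%N ->
  F3_0 (xb a) (xb b) =
    if (1 < a < n)%N && (b == 1%N) then xb a.+1
    else if (a == 1%N) && (1 < b < n)%N then - xb b.+1 else 0.
Proof.
move=> an bn; rewrite F3_0E.
have sumE c : \sum_(2 <= i < n) (c == i)%:R *: xb i.+1 =
    if (1 < c < n)%N then xb c.+1 else 0.
  transitivity (\sum_(2 <= i < n | i == c) xb i.+1); last by rewrite big_nat1_eq.
  rewrite [RHS]big_mkcond /=.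
  apply: eq_bigr => i _.
  by rewrite eq_sym; case: eqP => _; rewrite ?scale1r ?scale0r.
under eq_bigr do rewrite !xcoord_xb // scalerBl -scalerA scalerA mulrC -!scalerA.
rewrite sumrB -!scaler_sumr !sumE.
case: (b =P 1%N) => [-> | _]; case: (a =P 1%N) => [-> | _];
  rewrite ?andbF ?andbT ?ltnn ?scaler0 ?scale0r ?scale1r ?subr0 ?sub0r ?oppr0 //=.
by case: ifP; rewrite ?oppr0.
Qed.

Lemma F3_0_lie : is_lie F3_0.
Proof.
split=> [x | x y z].
  by rewrite F3_0E big1 // => i _; rewrite mulrC subrr scale0r.
pose S (u : L) : L := \sum_(2 <= i < n) xcoord i u *: xb i.+1.
have SL : linear S.
  move=> a u v; rewrite /S scaler_sumr -big_split /=.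
  by apply: eq_bigr => i _; rewrite (xcoordP i) scalerDl scalerA.
have muE u v : F3_0 u v = xcoord 1 v *: S u - xcoord 1 u *: S v.
  rewrite F3_0E /S !scaler_sumr -sumrB; apply: eq_bigr => i _.
  by rewrite scalerBl !scalerA [xcoord 1 v * _]mulrC.
have c1 u v : xcoord 1 (F3_0 u v) = 0.
  rewrite F3_0E /xcoord big1 // => j /eqP[j0]; rewrite summxE big_nat big1 //.
  move=> i /andP[i2 _]; rewrite !mxE j0 eqSS eq_sym -leqn0 leqNgt.
  by rewrite (ltnW i2) mulr0.
have SmuE u v : S (F3_0 u v) = xcoord 1 v *: S (S u) - xcoord 1 u *: S (S v).
  pose T : {linear L -> L} := HB.pack S (GRing.isLinear.Build _ _ _ _ S SL).
  by rewrite muE -[S]/(T : L -> L) linearB !linearZ.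
have mu2E u v w : F3_0 u (F3_0 v w) =
    (xcoord 1 u * xcoord 1 v) *: S (S w) - (xcoord 1 w * xcoord 1 u) *: S (S v).
  rewrite [LHS]muE c1 scale0r sub0r SmuE scalerBr opprB !scalerA.
  by rewrite [xcoord 1 w * _]mulrC.
rewrite !mu2E.
set A := _ *: S (S z); set B := _ *: S (S y); set C := _ *: S (S x).
by rewrite (addrC (A - B)) !subrKA subrr.
Qed.

End Filiform.

(* Main.v *)
From HB Require Import structures.
Require Import Defs.
From mathcomp Require Import all_boot all_order all_algebra.
From mathcomp Require Import complex reals ring.

(** Write [D x y = phi x y + phi y x] for the symmetrization of a Leibniz
    cocycle [phi] of a Lie algebra [mu].  Adding the cocycle identity to the one
    with two arguments exchanged makes almost everything cancel:

    - exchanging the last two arguments leaves [mu x (D y z) = 0], so [D] takes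
      values in the centre ([symmetrization_central]);
    - exchanging the first two leaves [D x (mu y z) + D y (mu x z) = 0], so [D]
      is an invariant symmetric form ([symmetrization_invariant]).

    In the filiform algebra the centre is the line of [xb n].  Invariance under
    [xb i] for [1 < i < n], which sends [xb 1] to a multiple of [xb i.+1] and
    kills the other basis vectors, shows that [D] vanishes as soon as one
    argument is in the span of [xb 3, ..., xb n].  Hence [D] is a symmetric form
    on the span of [xb 1] and [xb 2] with values in a line, and it is described
    by the coefficients of [xb n] in [D (xb 1) (xb 1)], [D (xb 1) (xb 2)] and
    [D (xb 2) (xb 2)].  All such forms are symmetrizations of combinations of
    [psi1], [psi2] and [psi3], so subtracting the right combination from [phi] leaves
    a skew cocycle.  Conversely the [psi]s are cocycles because they only see the first
    two coordinates, which vanish on brackets, and only take central values.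
    The sum is direct because a combination of the [psi]s whose symmetrization
    vanishes is zero.  The only scalar divided by is 2, so the argument runs
    over any field where 2 is invertible. *)

Set Implicit Arguments.
Unset Strict Implicit.
Unset Printing Implicit Defensive.

Import GRing.Theory Num.Theory.
Local Open Scope ring_scope.

(** * Symmetrized Leibniz cocycles of a Lie algebra *)

Section LieCocycle.
Variables (K : fieldType) (L : vectType K).
Implicit Types mu phi : 'Hom(L, 'Hom(L, L)).

Definition symmetrization phi (x y : L) : L := phi x y + phi y x.

Lemma symmetrizationC phi x y : symmetrization phi x y = symmetrization phi y x.
Proof. by rewrite /symmetrization addrC. Qed.

Lemma symmetrizationP phi x : linear (symmetrization phi x).
Proof.
by move=> a u v; rewrite /symmetrization hom2Pl hom2Pr scalerDr addrACA.
Qed.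

HB.instance Definition _ phi x :=
  GRing.isLinear.Build _ _ _ _ (symmetrization phi x) (symmetrizationP phi x).

Lemma lie_skew mu x y : is_lie mu -> mu x y = - mu y x.
Proof.
move=> [alt _]; apply/eqP; rewrite -addr_eq0; have := alt (x + y).
by rewrite hom2Dl !linearD /= !alt add0r addr0 addrC => ->.
Qed.

(** Apart from its first term and [phi x (mu y z)], the cocycle expression is
    skew in its last two arguments, and so is [mu y z]. *)
Lemma symmetrization_central mu phi x y z :
  is_lie mu -> phi \in ZL2 mu -> mu x (symmetrization phi y z) = 0.
Proof.
move=> muL /memZL2 phiZ; have := congr2 +%R (phiZ x y z) (phiZ x z y).
rewrite /cocycle_expr addr0 (lie_skew z y muL) [phi x (- _)]linearN /=.
rewrite /symmetrization linearD /= => <-.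
set a := mu x _; set b := mu _ z; set c := mu _ y; set d := phi x _.
set e := phi _ z; set f := phi _ y; set g := mu x _.
rewrite [RHS](AC (6*6) ((1*7)*(4*10)*(2*9)*(3*8)*(5*12)*(6*11))) /=.
by rewrite subrr !addNr !subrr !addr0.
Qed.

(** The terms of the two cocycle identities for [(x, y, z)] and [(y, x, z)] in
    which [mu] is outermost cancel by skewness, except for
    [- mu (symmetrization phi x y) z], which is zero by centrality. *)
Lemma symmetrization_invariant mu phi x y z :
    is_lie mu -> phi \in ZL2 mu ->
  symmetrization phi x (mu y z) + symmetrization phi y (mu x z) = 0.
Proof.
move=> muL phiZ; have central := symmetrization_central z x y muL phiZ.
have bE : mu (phi y x) z = - mu (phi x y) z.
  apply/eqP; rewrite -addr_eq0 addrC -hom2Dl (lie_skew _ _ muL).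
  by rewrite -/(symmetrization phi x y) central oppr0.
move/memZL2: phiZ => phiZ; have := congr2 +%R (phiZ x y z) (phiZ y x z).
rewrite /cocycle_expr addr0 bE (lie_skew (phi x z) y muL).
rewrite (lie_skew (phi y z) x muL) (lie_skew y x muL).
have -> : phi (- mu x y) z = - phi (mu x y) z.
  by rewrite [phi (- _)]linearN opp_lfunE.
rewrite !opprK /symmetrization => <-.
set a := mu x _; set b := mu _ z; set c := mu y _; set d := phi x _.
set e := phi _ z; set f := phi _ y; set g := phi y _; set h := phi _ x.
rewrite [RHS](AC (6*6) (((4*12)*(10*6))*(1*9)*(2*8)*(3*7)*(5*11))) /=.
by rewrite subrr !addNr !addr0.
Qed.

End LieCocycle.

(** * The filiform algebra *)

Section FiliformCocycle.
Variables (K : fieldType) (n : nat).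
Local Notation L := 'rV[K]_n.
Local Notation mu := (F3_0 K n).
Local Notation xb := (@xb K n).
Implicit Types (x y v : L) (phi : 'Hom(L, 'Hom(L, L))).

Lemma xcoordE i (lt_in : (i < n)%N) v : xcoord i.+1 v = v 0 (Ordinal lt_in).
Proof.
rewrite /xcoord (bigD1 (Ordinal lt_in)) //= big1 ?addr0 // => j.
by rewrite eqSS -val_eqE /= andbN.
Qed.

Lemma xcoord0 i : xcoord i (0 : L) = 0.
Proof. by rewrite /xcoord big1 // => j _; rewrite mxE. Qed.

Lemma xcoord_sum_xb k (F : nat -> K) m p :
  (m <= k < p)%N -> (k < n)%N ->
  xcoord k.+1 (\sum_(m <= i < p) F i *: xb i.+1) = F k.
Proof.
move=> mkp lt_kn; rewrite (xcoordE lt_kn) summxE.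
transitivity (\sum_(m <= i < p | i == k) F i); last by rewrite big_nat1_eq mkp.
rewrite [RHS]big_mkcond; apply: eq_bigr => i _.
by rewrite !mxE eqSS eq_sym; case: eqP => _; rewrite ?mulr1 ?mulr0.
Qed.

Lemma xb_expansion v : v = \sum_(1 <= i < n.+1) xcoord i v *: xb i.
Proof.
rewrite big_add1 /=; apply/rowP => -[j lt_jn].
by rewrite -!xcoordE xcoord_sum_xb.
Qed.

Hypothesis n_ge3 : (2 < n)%N.

Lemma xb_expansion12 v :
  v = xcoord 1 v *: xb 1 + xcoord 2 v *: xb 2
      + \sum_(2 <= i < n) xcoord i.+1 v *: xb i.+1.
Proof.
rewrite {1}[v]xb_expansion big_nat_recl ?(ltnW (ltnW n_ge3)) //.
by rewrite big_ltn ?(ltnW n_ge3) // addrA.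
Qed.

Lemma xcoord_bracket k x y : (k < 3)%N -> xcoord k (mu x y) = 0.
Proof.
move=> lt_k3; rewrite F3_0E /xcoord big1 // => j /eqP jk.
rewrite summxE big_nat big1 // => i /andP[i2 _]; rewrite !mxE jk.
by rewrite ltn_eqF ?mulr0 // (leq_trans lt_k3).
Qed.

Lemma bracket_xbn x : mu x (xb n) = 0.
Proof.
rewrite F3_0E big_nat big1 // => i /andP[i2 i_n].
rewrite !xcoord_xb ?leqnn ?(ltnW (ltnW n_ge3)) //.
by rewrite !gtn_eqF ?(ltnW n_ge3) // !mulr0 subrr scale0r.
Qed.

(** Bracketing with [xb 1] detects the coordinates 2 to [n.-1]; bracketing with
    [xb 2] detects the first one, because [xb 3] is not zero. *)
Lemma centralE v : (forall x, mu x v = 0) -> v = xcoord n v *: xb n.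
Proof.
move=> vC; have n_gt0 := ltnW (ltnW n_ge3).
have c1 : xcoord 1 v = 0.
  have := congr1 (xcoord 3) (vC (xb 2)).
  rewrite F3_0E xcoord_sum_xb ?n_ge3 // !xcoord_xb ?(ltnW n_ge3) //=.
  by rewrite mul1r mul0r subr0 xcoord0.
have ci i : (1 < i < n)%N -> xcoord i v = 0.
  move=> /andP[i2 i_n]; have := congr1 (xcoord i.+1) (vC (xb 1)).
  rewrite F3_0E xcoord_sum_xb ?i2 // !xcoord_xb // c1 mulr0 sub0r mul1r.
  by rewrite xcoord0 => /eqP; rewrite oppr_eq0 => /eqP.
rewrite {1}[v]xb_expansion big_nat_recr //= big_nat big1 ?add0r //.
move=> [|[|i]] // /andP[_ i_n]; first by rewrite c1 scale0r.
by rewrite ci ?scale0r.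
Qed.

(** In each of the six terms of the cocycle identity, either the central vector
    [xb n] is bracketed, or one of the first two coordinates of a bracket is
    taken. *)
Lemma elem_bilin_cocycle i j : (i < 3)%N -> (j < 3)%N ->
  elem_bilin K n i j n \in ZL2 mu.
Proof.
move=> lt_i3 lt_j3; apply/memZL2 => x y z; rewrite /cocycle_expr.
rewrite !(lie_skew (elem_bilin _ _ _ _ _ _ _) _ (F3_0_lie K n)) !elem_bilinE.
rewrite !linearZ /= !bracket_xbn !xcoord_bracket //.
by rewrite ?(mulr0, mul0r, scaler0, scale0r, oppr0, addr0).
Qed.

Hypothesis two_neq0 : 2%:R != 0 :> K.

(** The bracket on the right with [xb i] sends [xb 1] to [- xb i.+1] and the
    other basis vectors to 0, so invariance at [(xb 1, xb 1)] gives twice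
    the wanted value for [x = xb 1], and invariance at [(x, xb 1)] reduces [x]
    to [xb 1]. *)
Lemma symmetrization_bracket0 phi i x : phi \in ZL2 mu ->
  (1 < i < n)%N -> symmetrization phi x (xb i.+1) = 0.
Proof.
move=> phiZ /andP[i2 i_n]; have n_gt0 := ltnW (ltnW n_ge3).
pose D := symmetrization phi.
have brE y : mu y (xb i) = - xcoord 1 y *: xb i.+1.
  rewrite F3_0E (bigD1_seq i) ?mem_index_iota ?i2 ?iota_uniq //=.
  rewrite big_nat_cond big1 ?addr0.
    rewrite !xcoord_xb ?(ltnW i2) ?(ltnW i_n) // (gtn_eqF i2) eqxx.
    by rewrite mulr0 sub0r mulr1.
  move=> k /andP[_ ki]; rewrite !xcoord_xb ?(ltnW i2) ?(ltnW i_n) //.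
  by rewrite (gtn_eqF i2) eq_sym (negPf ki) !mulr0 subrr scale0r.
have inv y z : xcoord 1 z *: D y (xb i.+1) + xcoord 1 y *: D z (xb i.+1) = 0.
  have := symmetrization_invariant y z (xb i) (F3_0_lie K n) phiZ.
  rewrite !brE !linearZ /=.
  by rewrite !scaleNr -opprD => /eqP; rewrite oppr_eq0 => /eqP.
have D1 : D (xb 1) (xb i.+1) = 0.
  have := inv (xb 1) (xb 1); rewrite xcoord_xb // scale1r -mulr2n -scaler_nat.
  by move/eqP; rewrite scaler_eq0 (negPf two_neq0) => /eqP.
by have := inv x (xb 1); rewrite D1 scaler0 addr0 xcoord_xb // scale1r.
Qed.

Lemma symmetrization_expansion phi x y : phi \in ZL2 mu ->
  symmetrization phi x y =
    (xcoord 1 x * xcoord 1 y) *: symmetrization phi (xb 1) (xb 1)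
    + (xcoord 1 x * xcoord 2 y + xcoord 2 x * xcoord 1 y)
      *: symmetrization phi (xb 1) (xb 2)
    + (xcoord 2 x * xcoord 2 y) *: symmetrization phi (xb 2) (xb 2).
Proof.
move=> phiZ.
have DE u v : symmetrization phi u v =
    xcoord 1 v *: symmetrization phi u (xb 1)
    + xcoord 2 v *: symmetrization phi u (xb 2).
  rewrite {1}[v]xb_expansion12 2!linearD !linearZ linear_sum /=.
  rewrite big_nat big1 ?addr0 // => i i2n.
  by rewrite linearZ /= symmetrization_bracket0 // scaler0.
rewrite DE ![symmetrization phi x _]symmetrizationC (DE _ x) (DE (xb 2) x).
rewrite [symmetrization phi (xb 2) (xb 1)]symmetrizationC.
move: (symmetrization _ _ _) (symmetrization _ _ _) (symmetrization _ _ _).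
move=> d22 d12 d11; rewrite !scalerDr !scalerA scalerDl.
rewrite ![xcoord _ y * _]mulrC !addrA; congr (_ + _); rewrite -!addrA.
by congr (_ + _); rewrite addrC.
Qed.

(** * The complement spanned by the three cochains *)

Definition psis := [tuple psi1 K n; psi2 K n; psi3 K n].

Lemma psi_sum_xb (k : 'I_3 -> K) x y :
  (\sum_(i < 3) k i *: psis`_i) x y =
    (k ord0 * (xcoord 1 x * xcoord 1 y)
     + k (lift ord0 ord0) * (xcoord 1 x * xcoord 2 y)
     + k (lift ord0 (lift ord0 ord0)) * (xcoord 2 x * xcoord 2 y)) *: xb n.
Proof.
rewrite !big_ord_recl big_ord0 addr0 /= !hom2D.
have hom2Z a (f : 'Hom(L, 'Hom(L, L))) : (a *: f) x y = a *: f x y.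
  by rewrite !scale_lfunE.
by rewrite !hom2Z !elem_bilinE !scalerA addrA -!scalerDl.
Qed.

Lemma symmetrization_psi_sum (k : 'I_3 -> K) x y :
  symmetrization (\sum_(i < 3) k i *: psis`_i) x y =
    (k ord0 *+ 2 * (xcoord 1 x * xcoord 1 y)
     + k (lift ord0 ord0) * (xcoord 1 x * xcoord 2 y + xcoord 2 x * xcoord 1 y)
     + k (lift ord0 (lift ord0 ord0)) *+ 2 * (xcoord 2 x * xcoord 2 y)) *: xb n.
Proof.
rewrite /symmetrization !psi_sum_xb -scalerDl; congr (_ *: _); ring.
Qed.

Lemma xbn_neq0 : xb n != 0.
Proof.
have n_gt0 := ltnW (ltnW n_ge3).
apply: contraNneq (oner_neq0 K) => x0.
have <- : xcoord n (xb n) = 1 by rewrite xcoord_xb ?eqxx // n_gt0 leqnn.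
by rewrite x0 xcoord0.
Qed.

(** At [(xb 1, xb 1)], [(xb 1, xb 2)] and [(xb 2, xb 2)], the symmetrization of
    the combination isolates one scalar each time, up to a factor 2. *)
Lemma psi_sum_skew (k : 'I_3 -> K) :
    \sum_(i < 3) k i *: psis`_i \in skew_bilin (L : vectType K) ->
  forall i, k i = 0.
Proof.
move/mem_skew_bilin=> skew.
have sym0 x y : symmetrization (\sum_(i < 3) k i *: psis`_i) x y = 0.
  by rewrite /symmetrization skew addNr.
have ev a b := sym0 (xb a) (xb b).
have c0 a : a *: xb n = 0 -> a = 0.
  by move/eqP; rewrite scaler_eq0 (negPf xbn_neq0) orbF => /eqP.
have c20 (a : K) : a *+ 2 = 0 -> a = 0.
  by move/eqP; rewrite -mulr_natr mulf_eq0 (negPf two_neq0) orbF => /eqP.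
have in12 a : (0 < a < 3)%N -> (0 < a <= n)%N.
  by move=> /andP[-> /ltnW a3]; rewrite (leq_trans a3).
have k0 : k ord0 = 0.
  apply/c20/c0; rewrite -[RHS](ev 1 1) symmetrization_psi_sum.
  by rewrite !xcoord_xb ?in12 //= !(mulr0, mul0r, mulr1, addr0).
have k1 : k (lift ord0 ord0) = 0.
  apply/c0; rewrite -[RHS](ev 1 2) symmetrization_psi_sum.
  by rewrite !xcoord_xb ?in12 //= !(mulr0, mul0r, mulr1, addr0, add0r).
have k2 : k (lift ord0 (lift ord0 ord0)) = 0.
  apply/c20/c0; rewrite -[RHS](ev 2 2) symmetrization_psi_sum.
  by rewrite !xcoord_xb ?in12 //= !(mulr0, mul0r, mulr1, addr0, add0r).
case=> [[|[|[|i]]]] // lt_i3; [rewrite -k0 | rewrite -k1 | rewrite -k2];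
  by congr k; apply: val_inj.
Qed.

Lemma psis_free : free psis.
Proof.
by apply/freeP => k k0; apply: psi_sum_skew; rewrite k0 mem0v.
Qed.

Lemma psis_cocycle : (<<psis>> <= ZL2 mu)%VS.
Proof.
apply/span_subvP => f; rewrite !inE => /or3P[] /eqP ->;
  exact: elem_bilin_cocycle.
Qed.

(** By [symmetrization_central] and [centralE], the symmetrization of [phi] is a
    multiple of [xb n] at each pair of basis vectors; the coefficients at
    [(xb 1, xb 1)] and [(xb 2, xb 2)] are halved because [psi1] and [psi3] are
    symmetric. *)
Lemma ZL2_decomposition : ZL2 mu = (Z2 mu + <<psis>>)%VS.
Proof.
apply/eqP; rewrite eqEsubv subv_add capvSl psis_cocycle !andbT.
apply/subvP => phi phiZ; pose D := symmetrization phi.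
have DE x y : D x y = xcoord n (D x y) *: xb n.
  apply: centralE => u; exact: symmetrization_central (F3_0_lie K n) phiZ.
pose k (i : 'I_3) : K :=
  [:: xcoord n (D (xb 1) (xb 1)) / 2%:R; xcoord n (D (xb 1) (xb 2));
      xcoord n (D (xb 2) (xb 2)) / 2%:R]`_i.
pose psi := \sum_(i < 3) k i *: psis`_i.
have psiS : psi \in <<psis>>%VS.
  apply: memv_suml => i _; apply/memvZ/memv_span/mem_nth.
  by rewrite size_tuple.
have half (a : K) : a / 2%:R *+ 2 = a by rewrite -[_ *+ 2]mulr_natr divfK.
rewrite -(subrK psi phi) memv_add //; apply/memZ2; split.
  by rewrite memvB // (subvP psis_cocycle).
move=> x y; apply/eqP; rewrite -addr_eq0 !hom2D !hom2N addrACA -opprD.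
rewrite -[phi x y + _]/(D x y) -[psi x y + _]/(symmetrization psi x y) subr_eq0.
rewrite /D symmetrization_expansion // symmetrization_psi_sum /k /= !half.
rewrite -!/(D _ _) (DE (xb 1) (xb 1)) (DE (xb 1) (xb 2)) (DE (xb 2) (xb 2)).
rewrite !scalerA -!scalerDl -!DE.
by rewrite ![_ * xcoord n _]mulrC.
Qed.

Lemma ZL2_direct : directv (Z2 mu + <<psis>>)%VS.
Proof.
apply/directv_addP/eqP; rewrite -subv0; apply/subvP => f.
rewrite memv_cap => /andP[/memv_capP[_ fskew] /coord_span fE].
move: fskew; rewrite fE => /psi_sum_skew k0.
by rewrite big1 ?mem0v // => i _; rewrite k0 scale0r.
Qed.

End FiliformCocycle.

Local Open Scope complex_scope.

Theorem theorem3p21 (R : realType) (n : nat) (n_ge3 : (3 <= n)%N) :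
  let mu := F3_0 R[i] n in
  let psis := [:: psi1 R[i] n; psi2 R[i] n; psi3 R[i] n] in
  [/\ ZL2 mu = (Z2 mu + <<psis>>)%VS,
      directv (Z2 mu + <<psis>>)%VS
    & free psis].
Proof.
have two_neq0 : 2%:R != 0 :> R[i] by rewrite pnatr_eq0.
split; [exact: ZL2_decomposition | exact: ZL2_direct | exact: psis_free].
Qed.
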